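(* For all integers $m\ge n\ge0$ the polynomials $f_{m,n}(z_1,z_2;\beta)$ satisfy $$z_2f_{m+1,n}(z_1,z_2;\beta)=\frac{c_0(n,m-n+1+\beta)}{c_0(n+1,m-n+\beta)}f_{m+1,n+1}(z_1,z_2;\beta)-\frac{c_0(n,m-n+1+\beta)\,c_{n+1}(n+1,m-n+\beta)}{c_0(n+1,m-n+\beta)\,c_n(n,m-n+\beta)}f_{m,n}(z_1,z_2;\beta).$$
   Context: $\mu$ is a positive Borel measure on $[0,\infty)$, and for every real $\alpha\ge0$, $\{\phi_n(r;\alpha)\}_{n\ge0}$ is a system of polynomials, $\phi_n(\cdot;\alpha)$ of exact degree $n$, with $\int_0^\infty\phi_m(r;\alpha)\phi_n(r;\alpha)r^\alpha d\mu(r)=\zeta_n(\alpha)\delta_{m,n}$, where $\zeta_n(\alpha)>0$ for all $n$, and $\mu$ does not depend on $\alpha$. Write $\phi_n(r;\alpha)=\sum_{j=0}^n c_j(n,\alpha)r^{n-j}$ with $c_j(n,\alpha)\in\mathbb R$. (The zeros of $\phi_n(\cdot;\alpha)$ lie in $(0,\infty)$, so $c_n(n,\alpha)=\phi_n(0;\alpha)\ne0$.) For $\beta\ge0$ and nonnegative integers $m,n$ define $f_{m,n}(z_1,z_2;\beta)=z_1^{m-n}\phi_n(z_1z_2;m-n+\beta)$ if $m\ge n$, and $f_{m,n}(z_1,z_2;\beta)=f_{n,m}(z_2,z_1;\beta)$ if $m<n$, where $z_1,z_2\in\mathbb C$. *)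

(* Defs.v *)
From HB Require Import structures.
From mathcomp Require Import all_boot all_order all_algebra.
From mathcomp Require Import all_classical all_reals all_analysis.
From mathcomp Require Import complex.

Set Implicit Arguments.
Unset Strict Implicit.
Unset Printing Implicit Defensive.

Import Order.TTheory GRing.Theory Num.Theory.
Local Open Scope classical_set_scope.
Local Open Scope ring_scope.

(* A positive Borel measure on [0, +oo[ is represented by a Borel measure on R
   that does not charge ]-oo, 0[. *)
Definition on_nonneg (R : realType)
    (mu : {measure set (measurableTypeR R) -> \bar R}) : Prop :=
  mu [set r : R | r < 0] = 0%E.

(* [phi n alpha] is phi_n( . ; alpha). Only the values at alpha >= 0 are
   constrained; [size p = n.+1] means degree exactly n; and [0 `^ 0 = 1], so
   that for alpha = 0 the weight is 1 on the whole of [0, +oo[. Integrability is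
   spelled out since the library's integral is total. *)
Definition orthogonal_system (R : realType)
    (mu : {measure set (measurableTypeR R) -> \bar R})
    (phi : nat -> R -> {poly R}) (zeta : nat -> R -> R) : Prop :=
  forall alpha : R, 0 <= alpha ->
    [/\ forall n : nat, size (phi n alpha) = n.+1,
        forall n : nat, 0 < zeta n alpha &
        forall m n : nat,
          let g (r : measurableTypeR R) : \bar R :=
            ((phi m alpha).[r] * (phi n alpha).[r] * r `^ alpha)%:E in
          mu.-integrable `[0, +oo[ g /\
          (\int[mu]_(r in `[0%R, +oo[) g r)%E =
            (if m == n then zeta n alpha else 0)%:E].

(* Coefficients are numbered from the top:
   phi_n(r; alpha) = \sum_(0 <= j <= n) c_j(n, alpha) r^(n - j). *)
Definition c (R : realType) (phi : nat -> R -> {poly R})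
    (j n : nat) (alpha : R) : R :=
  (phi n alpha)`_(n - j).

Definition f_ge (R : realType) (phi : nat -> R -> {poly R}) (beta : R)
    (m n : nat) (z1 z2 : R[i]) : R[i] :=
  z1 ^+ (m - n) *
  (map_poly (real_complex R) (phi n ((m - n)%:R + beta))).[z1 * z2].

Definition f (R : realType) (phi : nat -> R -> {poly R}) (beta : R)
    (m n : nat) (z1 z2 : R[i]) : R[i] :=
  if (n <= m)%N then f_ge phi beta m n z1 z2 else f_ge phi beta n m z2 z1.

(* Main.v *)
Require Import Defs.
From HB Require Import structures.
From mathcomp Require Import all_boot all_order all_algebra.
From mathcomp Require Import all_classical all_reals all_analysis.
From mathcomp Require Import complex.
From mathcomp Require Import ring.

Set Implicit Arguments.
Unset Strict Implicit.
Unset Printing Implicit Defensive.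

Import Order.TTheory GRing.Theory Num.Theory.
Local Open Scope ring_scope.
Local Open Scope complex_scope.

(** Fix [alpha >= 0] and let [L p] be the integral of [p(r) r^alpha], a linear
    functional on polynomials for which the [P n := phi n alpha] are
    orthogonal; let [L'] and [P' n := phi n (alpha + 1)] be the same objects at
    [alpha + 1].  Since [r * r^alpha = r^(alpha + 1)] on the half line,
    [L ('X * p) = L' p]: passing from [alpha] to [alpha + 1] is the Christoffel
    modification of the functional at the node 0.

    With [z1 z2 = r] and a common factor [z1 ^ (m - n)] removed, the theorem is
    Christoffel's formula [christoffel_formula] expressing ['X * P' n] through
    [P n.+1] and [P n].  That formula holds because [L ('X * P' n * q)] is
    [L' (P' n * q)], which vanishes as soon as [q] has degree less than [n]; so
    only two terms of the expansion of ['X * P' n] along the [P i] survive.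
    Leading coefficients determine the first one and evaluation at 0 the second.

    Evaluation at 0 determines the second one only if [P n] does not vanish at
    0 ([orthogonal_at0_neq0]).  If [P n = q * 'X], then [L' (q * q) = L (q * P n)]
    is zero by orthogonality, whereas expanding [q] along the [P' i] shows that
    [L' (q * q)] is positive. *)

(** * Orthogonal polynomials for a linear functional *)

Section Functional.
Variable K : realFieldType.
Implicit Types (L : {scalar {poly K}}) (P : nat -> {poly K}) (p q : {poly K}).

Definition orthogonal_for L P (zeta : nat -> K) : Prop :=
  [/\ forall n, size (P n) = n.+1,
      forall n, 0 < zeta n &
      forall m n, L (P m * P n) = if m == n then zeta n else 0].

Lemma graded_lead_neq0 P (szP : forall n, size (P n) = n.+1) n :
  (P n)`_n != 0.
Proof.
have := lead_coef_eq0 (P n).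
by rewrite lead_coefE szP -size_poly_eq0 szP => ->.
Qed.

Lemma graded_expansion P (szP : forall n, size (P n) = n.+1) n p :
  (size p <= n)%N -> exists a : nat -> K, p = \sum_(i < n) a i *: P i.
Proof.
elim: n p => [|n IHn] p szp.
  exists (fun=> 0); rewrite big_ord0; apply/eqP.
  by rewrite -size_poly_eq0 -leqn0.
have lead_neq0 := graded_lead_neq0 szP n.
pose b := p`_n / (P n)`_n.
have [|a Ea] := IHn (p - b *: P n).
  apply/leq_sizeP => j; rewrite leq_eqVlt => /orP[/eqP <-|ltnj].
    by rewrite coefB coefZ divfK ?subrr.
  rewrite coefB coefZ !nth_default ?mulr0 ?subrr ?szP //.
  exact: leq_trans szp _.
exists (fun i => if i == n then b else a i).
rewrite big_ord_recr /= eqxx.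
under eq_bigr => i _ do rewrite ltn_eqF //.
by rewrite -Ea subrK.
Qed.

Section Orthogonal.
Variables (L : {scalar {poly K}}) (P : nat -> {poly K}) (zeta : nat -> K).
Hypothesis orthP : orthogonal_for L P zeta.

Lemma orthogonal_coef n (a : nat -> K) k :
  (k < n)%N -> L ((\sum_(i < n) a i *: P i) * P k) = a k * zeta k.
Proof.
case: orthP => _ _ dotP ltkn.
rewrite mulr_suml linear_sum (bigD1 (Ordinal ltkn)) //= big1 => [|i neik].
  by rewrite addr0 -scalerAl linearZ /= dotP eqxx.
rewrite -scalerAl linearZ /= dotP; case: eqP => [eik|_]; last exact: mulr0.
by case/eqP: neik; apply: val_inj.
Qed.

Lemma orthogonal_low_degree n p : (size p <= n)%N -> L (p * P n) = 0.
Proof.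
case: orthP => szP _ dotP /(graded_expansion szP)[a ->].
rewrite mulr_suml linear_sum big1 // => i _.
by rewrite -scalerAl linearZ /= dotP ltn_eqF // mulr0.
Qed.

(** The expansion [p = \sum_i a i *: P i] gives [L (p * p)] as the weighted sum
    of squares of the [a i]. *)
Lemma functional_sqr_gt0 p : p != 0 -> 0 < L (p * p).
Proof.
case: (orthP) => szP zeta_gt0 _ p_neq0.
have [a Ea] := graded_expansion szP (leqnn (size p)).
have coefp k : (k < size p)%N -> L (p * P k) = a k * zeta k.
  by move=> ltk; rewrite [in LHS]Ea orthogonal_coef.
have -> : L (p * p) = \sum_(i < size p) a i ^+ 2 * zeta i.
  rewrite {2}Ea mulr_sumr linear_sum; apply: eq_bigr => i _.
  by rewrite -scalerAr linearZ /= coefp // mulrA -expr2.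
have term_ge0 (i : 'I_(size p)) : true -> 0 <= a i ^+ 2 * zeta i.
  by move=> _; rewrite mulr_ge0 ?sqr_ge0 // ltW.
rewrite lt0r sumr_ge0 // andbT; apply: contra p_neq0 => /eqP sum0.
rewrite Ea big1 // => i _.
have /eqP := psumr_eq0P term_ge0 sum0 (i := i) isT.
by rewrite mulf_eq0 (gt_eqF (zeta_gt0 i)) orbF sqrf_eq0 => /eqP ->; rewrite scale0r.
Qed.

End Orthogonal.

(** * The Christoffel modification at 0 *)

Section Christoffel.
Variables (L L' : {scalar {poly K}}) (P P' : nat -> {poly K}).
Variables (zeta zeta' : nat -> K).
Hypothesis orthP : orthogonal_for L P zeta.
Hypothesis orthP' : orthogonal_for L' P' zeta'.
Hypothesis LX : forall p, L ('X * p) = L' p.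

(** A factorisation [P n = q * 'X] would give [L' (q * q) = L (q * P n) = 0]
    with [q] nonzero. *)
Lemma orthogonal_at0_neq0 n : (P n)`_0 != 0.
Proof.
case: (orthP) => szP _ _; apply/negP => /eqP Pn0.
have /factor_theorem[q] : root (P n) 0 by rewrite /root horner_coef0 Pn0.
rewrite subr0 => EPn.
have q_neq0 : q != 0.
  by apply: contra_eq_neq (szP n) => q0; rewrite EPn q0 mul0r size_poly0.
have szq : (size q <= n)%N.
  by have := szP n; rewrite EPn size_mulX // => -[->].
have := functional_sqr_gt0 orthP' q_neq0.
by rewrite -LX -commr_polyX -mulrA -EPn (orthogonal_low_degree orthP) ?ltxx.
Qed.

(** By [LX], ['X * P' n] is orthogonal for [L] to every polynomial of degree
    less than [n], so its expansion along the [P i] has two terms; comparing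
    the coefficients of degree [n.+1] and 0 identifies them. *)
Lemma christoffel_formula n :
  'X * P' n = ((P' n)`_n / (P n.+1)`_n.+1) *: P n.+1
    - ((P' n)`_n * (P n.+1)`_0 / ((P n.+1)`_n.+1 * (P n)`_0)) *: P n.
Proof.
case: (orthP) (orthP') => szP zeta_gt0 _ [szP' _ _].
have [|a Ea] := graded_expansion szP (n := n.+2) (p := 'X * P' n).
  by rewrite -commr_polyX size_mulX ?szP' // -size_poly_eq0 szP'.
have a_low i : (i < n)%N -> a i = 0.
  move=> ltin; have /eqP := orthogonal_coef orthP a (ltn_trans ltin (leqnSn n.+1)).
  rewrite -Ea -mulrA LX mulrC (orthogonal_low_degree orthP') ?szP //.
  by rewrite eq_sym mulf_eq0 (gt_eqF (zeta_gt0 i)) orbF => /eqP.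
have {}Ea : 'X * P' n = a n *: P n + a n.+1 *: P n.+1.
  rewrite Ea !big_ord_recr /= big1 ?add0r // => i _.
  by rewrite a_low // scale0r.
have lead_neq0 := graded_lead_neq0 szP n.+1.
have at0_neq0 := orthogonal_at0_neq0 n.
have a_top : a n.+1 = (P' n)`_n / (P n.+1)`_n.+1.
  have := congr1 (fun p : {poly K} => p`_n.+1) Ea.
  rewrite coefXM /= coefD !coefZ [(P n)`_n.+1]nth_default ?szP // mulr0 add0r.
  by move=> ->; rewrite mulfK.
have a_next : a n = - ((P' n)`_n * (P n.+1)`_0 / ((P n.+1)`_n.+1 * (P n)`_0)).
  have := congr1 (fun p : {poly K} => p`_0) Ea.
  rewrite coefXM /= coefD !coefZ a_top => /esym/eqP; rewrite addr_eq0 => /eqP Ean.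
  by apply: (mulIf at0_neq0); rewrite Ean; field; apply/andP.
by rewrite Ea a_top a_next scaleNr addrC.
Qed.

End Christoffel.

End Functional.

(** * The functionals given by the weights r^alpha *)

Section Moments.
Variables (R : realType) (mu : {measure set (measurableTypeR R) -> \bar R}).
Variables (phi : nat -> R -> {poly R}) (zeta : nat -> R -> R).
Hypothesis hphi : orthogonal_system mu phi zeta.

Definition weighted (alpha : R) (p : {poly R}) (r : measurableTypeR R) : R :=
  p.[r] * r `^ alpha.

Definition moment (alpha : R) (p : {poly R}) : R :=
  \int[mu]_(r in `[0, +oo[%classic) weighted alpha p r.

(** The products [phi k alpha * phi 0 alpha] are integrable by assumption, and
    [phi 0 alpha] is a nonzero constant, so the [phi k alpha], hence all
    polynomials, are integrable against the weight. *)
Lemma integrable_weighted alpha p : 0 <= alpha ->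
  mu.-integrable `[0, +oo[%classic (EFin \o weighted alpha p).
Proof.
move=> alpha_ge0; case: (hphi alpha_ge0) => szphi _ dotphi.
have mD : measurable (`[0, +oo[%classic : set (measurableTypeR R)).
  exact: measurable_itv.
have [a ->] := graded_expansion szphi (leqnn (size p)).
have [d d_neq0 Ed] : exists2 d, d != 0 & phi 0%N alpha = d%:P.
  by apply/size_poly1P; rewrite szphi.
have -> : EFin \o weighted alpha (\sum_(i < size p) a i *: phi i alpha) =
    (fun r => \sum_(i < size p) (a i / d)%:E *
       ((phi i alpha).[r] * (phi 0%N alpha).[r] * r `^ alpha)%:E)%E.
  apply/funext => r; rewrite /weighted /= horner_sum mulr_suml -sumEFin.
  apply: eq_bigr => i _; rewrite -EFinM hornerZ Ed hornerC; congr EFin.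
  by field.
apply: integrable_sum => // i _.
have [int_prod _] := dotphi i 0%N.
exact: (integrableZl mD (a i / d) int_prod).
Qed.

Lemma moment_linear alpha : 0 <= alpha ->
  linear_for *%R (moment alpha).
Proof.
move=> alpha_ge0 k p q; rewrite /moment.
have mD : measurable (`[0, +oo[%classic : set (measurableTypeR R)).
  exact: measurable_itv.
have ip := integrable_weighted p alpha_ge0.
have iq := integrable_weighted q alpha_ge0.
rewrite -RintegralZl // -RintegralD //; last first.
  exact: (integrableZl mD k ip).
apply: eq_Rintegral => r _.
by rewrite /weighted hornerD hornerZ mulrDl mulrA.
Qed.

Lemma moment_functional alpha : 0 <= alpha ->
  exists L : {scalar {poly R}}, forall p, L p = moment alpha p.
Proof.
move=> alpha_ge0.
pose lin := GRing.isLinear.Build R {poly R} R *%R (moment alpha)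
  (moment_linear alpha_ge0).
by exists (HB.pack_for {scalar {poly R}} (moment alpha) lin).
Qed.

Lemma moment_orthogonal alpha (L : {scalar {poly R}}) : 0 <= alpha ->
  (forall p, L p = moment alpha p) ->
  orthogonal_for L (phi^~ alpha) (zeta^~ alpha).
Proof.
move=> alpha_ge0 EL; case: (hphi alpha_ge0) => szphi zeta_gt0 dotphi.
split=> // m n; rewrite EL /moment /Rintegral.
have [_ dot] := dotphi m n.
by under eq_integral do rewrite /weighted hornerM; rewrite dot.
Qed.

Lemma momentXM alpha p : 0 <= alpha -> moment alpha ('X * p) = moment (alpha + 1) p.
Proof.
move=> alpha_ge0; apply: eq_Rintegral => r.
rewrite inE /= in_itv /= andbT => r_ge0.
rewrite /weighted hornerM hornerX mulrAC mulrC; congr (_ * _).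
(* At r = 0 the additivity of the exponent requires alpha + 1 to be nonzero. *)
have alpha1_neq0 : alpha + 1 != 0 by rewrite gt_eqF // ltr_wpDl.
by rewrite powRD ?(negbTE alpha1_neq0) // powRr1 // mulrC.
Qed.

Lemma christoffel_moment alpha n : 0 <= alpha ->
  'X * phi n (alpha + 1) =
    (c phi 0 n (alpha + 1) / c phi 0 n.+1 alpha) *: phi n.+1 alpha
    - (c phi 0 n (alpha + 1) * c phi n.+1 n.+1 alpha /
         (c phi 0 n.+1 alpha * c phi n n alpha)) *: phi n alpha.
Proof.
move=> alpha_ge0; have alpha1_ge0 : 0 <= alpha + 1 by rewrite addr_ge0.
have [L EL] := moment_functional alpha_ge0.
have [L' EL'] := moment_functional alpha1_ge0.
rewrite /c !subn0 !subnn.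
apply: (christoffel_formula (moment_orthogonal alpha_ge0 EL)
          (moment_orthogonal alpha1_ge0 EL')) => p.
by rewrite EL EL' momentXM.
Qed.

End Moments.

Theorem theorem2p3 (R : realType)
    (mu : {measure set (measurableTypeR R) -> \bar R})
    (phi : nat -> R -> {poly R}) (zeta : nat -> R -> R)
    (hmu : on_nonneg mu) (hphi : orthogonal_system mu phi zeta)
    (beta : R) (hbeta : 0 <= beta)
    (m n : nat) (hmn : (n <= m)%N) (z1 z2 : R[i]) :
  z2 * f phi beta m.+1 n z1 z2 =
    (c phi 0 n ((m - n)%:R + 1 + beta) /
       c phi 0 n.+1 ((m - n)%:R + beta))%:C * f phi beta m.+1 n.+1 z1 z2
    - (c phi 0 n ((m - n)%:R + 1 + beta) *
         c phi n.+1 n.+1 ((m - n)%:R + beta) /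
       (c phi 0 n.+1 ((m - n)%:R + beta) *
          c phi n n ((m - n)%:R + beta)))%:C * f phi beta m n z1 z2.
Proof.
have alpha_ge0 : 0 <= (m - n)%:R + beta by rewrite addr_ge0.
have leS : (n <= m.+1)%N by exact: leqW.
rewrite /f /f_ge leS ltnS hmn subSS (subSn hmn) -addn1 natrD.
rewrite [_ + 1 + beta]addrAC.
set alpha := (m - n)%:R + beta in alpha_ge0 *.
have := congr1 (fun p => (map_poly (real_complex R) p).[z1 * z2])
  (christoffel_moment hphi n alpha_ge0).
rewrite rmorphB rmorphM /= map_polyX !map_polyZ /= hornerM hornerX hornerD hornerN.
rewrite !hornerZ addn1 => Ephi.
rewrite exprS.
rewrite [LHS](_ : _ = z1 ^+ (m - n) * (z1 * z2 * (map_poly (real_complex R)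
  (phi n (alpha + 1))).[z1 * z2])); last by ring.
rewrite Ephi; ring.
Qed.
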